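(* Let $1\le q<p<\infty$ and $\alpha\in\left(\frac{p-q}{p},1\right]$. Then the Mazur map $M_{p,q}\colon \ell_p\to \ell_q$ is a coarse map which is expanding at rate $\alpha$. Moreover, $M_{p,q}$ is linearly expanding at rate $1$.
   Context: For $p,q\in[1,\infty)$, the Mazur map $M_{p,q}\colon \ell_p\to\ell_q$ is defined as follows. For $x=(x_n)_n$ in the unit sphere of $\ell_p$, $M_{p,q}(x)=(\mathrm{sign}(x_n)|x_n|^{p/q})_n$ (an element of the unit sphere of $\ell_q$); it is extended to all of $\ell_p$ by $M_{p,q}(x)=\|x\|M_{p,q}(x/\|x\|)$ for $x\neq 0$ and $M_{p,q}(0)=0$. A map $f\colon X\to Y$ between Banach spaces is coarse if $\omega_f(t)=\sup\{\|f(x)-f(z)\| : \|x-z\|\le t\}<\infty$ for all $t\ge 0$. For $\alpha\in[0,1]$, a map $f\colon X\to Y$ between Banach spaces is expanding at rate $\alpha$ if for every $L>0$ there is a map $\rho\colon[0,\infty)\to[0,\infty)$ with $\lim_{t\to\infty}\rho(t)=\infty$ such that, for all $x,z\in X$, $\|x-z\|\ge L\max\{\|x\|^\alpha,\|z\|^\alpha\}+L$ implies $\|f(x)-f(z)\|\ge\rho(\|x-z\|)$. It is linearly expanding at rate $\alpha$ if for every $L>0$ there is $C>0$ such that, for all $x,z\in X$, $\|x-z\|\ge L\max\{\|x\|^\alpha,\|z\|^\alpha\}+L$ implies $\|f(x)-f(z)\|\ge \frac{1}{C}\|x-z\|-C$. *)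

(* Defs.v *)
From HB Require Import structures.
From mathcomp Require Import all_boot all_order all_algebra.
From mathcomp Require Import all_classical all_reals all_analysis.

Set Implicit Arguments.
Unset Strict Implicit.
Unset Printing Implicit Defensive.

Import Order.TTheory GRing.Theory Num.Def Num.Theory.
Import numFieldNormedType.Exports.

Local Open Scope classical_set_scope.
Local Open Scope ring_scope.

Section lp_space.
Context (R : realType) (p : R) (p1 : 1 <= p).

(* Every f : nat -> R is measurable here and counting-a.e. equality is equality,
   so the elements of this L^p type are exactly the p-summable real sequences. *)
Definition lp : Type :=
  LfunType (@counting nat R) (p1 : (1 <= p%:E)%E).

HB.instance Definition _ := GRing.Lmodule.on lp.

Definition lp_norm (x : lp) : R :=
  fine ('N[@counting nat R]_(p%:E) [EFin \o (x : nat -> R)])%E.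

Lemma lp_normD (x y : lp) : lp_norm (x + y) <= lp_norm x + lp_norm y.
Proof. exact: ler_LnormD. Qed.

Lemma lp_normE (x : lp) :
  (lp_norm x)%:E = ((\sum_(n <oo) (`|x n| `^ p)%:E) `^ p^-1)%E.
Proof.
by rewrite finite_norm_fine Lnorm_counting// (lt_le_trans ltr01).
Qed.

Lemma lp_normZ (a : R) (x : lp) : lp_norm (a *: x) = `|a| * lp_norm x.
Proof.
apply: EFin_inj; rewrite EFinM !finite_norm_fine.
exact: LnormZ.
Qed.

Lemma lp_norm0_eq0 (x : lp) : lp_norm x = 0 -> x = 0.
Proof.
move=> x0; have := lp_normE x; rewrite x0 => /esym/poweR_eq0_eq0 s0.
have {}s0 : (\sum_(n <oo) (`|x n| `^ p)%:E = 0)%E.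
  by apply: s0; apply: nneseries_ge0 => k _ _; rewrite lee_fin powR_ge0.
apply/LfuneqP => n; apply/eqP; rewrite -normr_eq0.
have p0 : p != 0 by rewrite gt_eqF// (lt_le_trans ltr01).
have : ((`|x n| `^ p)%:E <= \sum_(n <oo) (`|x n| `^ p)%:E)%E.
  apply: le_trans (nneseries_lim_ge n.+1 _); last first.
    by move=> k _ _; rewrite lee_fin powR_ge0.
  rewrite big_nat_recr//=; apply: leeDr.
  by apply: sume_ge0 => k _; rewrite lee_fin powR_ge0.
rewrite s0 -[0%E]/(0%:E) lee_fin => h.
have : `|x n| `^ p == 0 by rewrite eq_le h powR_ge0.
by rewrite powR_eq0 => /andP[].
Qed.

HB.instance Definition _ :=
  Lmodule_isNormed.Build R lp lp_normD lp_normZ lp_norm0_eq0.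

End lp_space.

Section mazur_map.
Context (R : realType) (p q : R) (p1 : 1 <= p) (q1 : 1 <= q).

Definition mazur_seq (x : nat -> R) : nat -> R :=
  fun n => Num.sg (x n) * `|x n| `^ (p / q).

Lemma mazur_seq_Lfun (x : lp p1) :
  mazur_seq x \in Lfun (@counting nat R) q%:E.
Proof.
have p0 : 0 < p by rewrite (lt_le_trans ltr01).
have q0 : 0 < q by rewrite (lt_le_trans ltr01).
apply/andP; split; rewrite inE//= /finite_norm Lnorm_counting//.
rewrite poweR_lty// (_ : (\sum_(n <oo) _)%E = (\sum_(n <oo) (`|x n| `^ p)%:E)%E).
  apply: (@lty_poweRy _ _ p^-1); first by rewrite gt_eqF// invr_gt0.
  by rewrite -lp_normE ltry.
apply: eq_eseriesr => n _ /=; congr EFin.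
rewrite normrM (ger0_norm (powR_ge0 _ _)) normr_sg.
have [->|xn0] := eqVneq (x n) 0.
  by rewrite mul0r normr0 !powR0 ?gt_eqF.
by rewrite mul1r -powRrM divfK ?gt_eqF.
Qed.

(* The defining formula makes sense on all of l_p; [mazur] uses it only on the
   unit sphere. *)
Definition mazur_sphere (x : lp p1) : lp q1 :=
  Lfun_Sub (q1 : (1 <= q%:E)%E) (mazur_seq_Lfun x).

Definition mazur (x : lp p1) : lp q1 :=
  if x == 0 then 0 else `|x| *: mazur_sphere (`|x|^-1 *: x).

End mazur_map.

Arguments mazur_sphere {R p q} p1 q1 x.
Arguments mazur {R p q} p1 q1 x.

Section coarse_maps.
Context (R : realType) (X Y : normedModType R).
Implicit Types f : X -> Y.

(* For 0 <= t the set contains 0 (take x = z), so the supremum is never -oo. *)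
Definition expansion_modulus f (t : R) : \bar R :=
  ereal_sup [set r | exists x z, `|x - z| <= t /\ r = `|f x - f z|%:E].

Definition coarse f := forall t : R, 0 <= t -> (expansion_modulus f t < +oo)%E.

(* A map [0, +oo[ -> [0, +oo[ is represented by a real function that is
   nonnegative on [0, +oo[; only its values there are used.
   Note that 0 `^ 0 = 1. *)
Definition expanding_at_rate (alpha : R) f :=
  forall L : R, 0 < L -> exists rho : R -> R,
    [/\ forall t, 0 <= t -> 0 <= rho t,
        rho t @[t --> +oo] --> +oo &
        forall x z,
          L * maxr (`|x| `^ alpha) (`|z| `^ alpha) + L <= `|x - z| ->
          rho `|x - z| <= `|f x - f z| ].

Definition linearly_expanding_at_rate (alpha : R) f :=
  forall L : R, 0 < L -> exists2 C : R, 0 < C &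
    forall x z,
      L * maxr (`|x| `^ alpha) (`|z| `^ alpha) + L <= `|x - z| ->
      C^-1 * `|x - z| - C <= `|f x - f z|.

End coarse_maps.

(* Main.v *)
(* Put r = p/q > 1 and phi(a) = sign(a)|a|^r.  The scalar estimates
     2^-r |a - b|^r <= |phi(a) - phi(b)| <= r |a - b| max(|a|, |b|)^(r-1)
   summed over the coordinates show that on the unit sphere the Mazur map M is
   Lipschitz and satisfies |M u - M v| >= c |u - v|^r.  The positively
   homogeneous extension of a sphere-valued Lipschitz map is Lipschitz, hence
   coarse.  For the lower bound let s = max(|x|, |z|), d = |x - z| and
   D = |M x - M z|.  Either D >= d / 2, or the radial parts of x and z differ by
   less than d / 2, and then homogeneity gives D >= c' s^(1-r) d^r.  If moreover
   d >= L s^alpha, this is at least c'' d^b with b = r - (r-1)/alpha, which is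
   positive exactly when alpha > (p-q)/p, and equals 1 when alpha = 1. *)
Require Import Defs.
From mathcomp Require Import all_boot all_order all_algebra.
From mathcomp Require Import all_classical all_reals all_analysis.
From mathcomp Require Import lra ring.
Import Order.TTheory GRing.Theory Num.Theory.
Import numFieldNormedType.Exports.
Local Open Scope classical_set_scope.
Local Open Scope ring_scope.

(** * Scalar inequalities for signed powers *)

Section signed_power.
Context {R : realType}.
Implicit Types (a b r t p q : R).

Definition signed_powR r a : R := Num.sg a * `|a| `^ r.

Lemma signed_powRN r a : signed_powR r (- a) = - signed_powR r a.
Proof. by rewrite /signed_powR sgrN normrN mulNr. Qed.

Lemma ge0_signed_powR r a : 0 < r -> 0 <= a -> signed_powR r a = a `^ r.
Proof.
move=> r0; rewrite /signed_powR le_eqVlt => /orP[/eqP <-|a0].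
  by rewrite sgr0 mul0r powR0 ?gt_eqF.
by rewrite gtr0_sg // mul1r gtr0_norm.
Qed.

Lemma le_powR2r r a b : 0 <= r -> 0 <= a -> a <= b -> a `^ r <= b `^ r.
Proof.
by move=> r0 a0 ab; apply: ge0_ler_powR; rewrite ?nnegrE // (le_trans a0).
Qed.

(* Young's inequality [t * 1 <= t^r / r + 1 / r'] is Bernoulli's inequality. *)
Lemma bernoulli_powR r t : 1 <= r -> 0 <= t -> 1 + r * (t - 1) <= t `^ r.
Proof.
(* The exponent 1 has no finite conjugate exponent and is treated apart. *)
rewrite le_eqVlt => /orP[/eqP <-|r1] t0.
  by rewrite powRr1 // mul1r addrC subrK.
have r0 : 0 < r by lra.
have r10 : 0 < r - 1 by lra.
have := @conjugate_powR R t 1 r (r / (r - 1)) t0 ler01 r0 (divr_gt0 r0 r10).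
rewrite powR1 invf_div mulr1 => /(_ _)/wrap[]; first by field; lra.
rewrite mul1r -(ler_pM2l r0) mulrDr !mulrA ![r * _]mulrC !mulfK ?gt_eqF //.
lra.
Qed.

(** Swapping and a common change of sign reach [|b| <= a]. Both scalar estimates then split into the
    case of equal signs and the case of opposite signs. *)
Lemma sign_symmetric_ind (P : R -> R -> Prop) :
  (forall a b, P a b -> P b a) -> (forall a b, P a b -> P (- a) (- b)) ->
  (forall a b, 0 <= b <= a -> P a b) ->
  (forall a b, 0 <= b <= a -> P a (- b)) ->
  forall a b, P a b.
Proof.
move=> Psym Popp Ppos Pneg a b.
wlog ab : a b / `|b| <= `|a|.
  by move=> h; case/orP: (le_total `|b| `|a|) => /h // /Psym.
wlog a0 : a b ab / 0 <= a.
  move=> h; case/orP: (le_total 0 a) => [/h|a0]; first exact.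
  by rewrite -[a]opprK -[b]opprK; apply/Popp/h; rewrite ?normrN // oppr_ge0.
rewrite (ger0_norm a0) in ab.
have [b0|b0] := leP 0 b; first by apply: Ppos; rewrite b0 -(ger0_norm b0).
rewrite -[b]opprK; apply: Pneg; rewrite ltr0_norm // in ab.
by rewrite ab andbT oppr_ge0 ltW.
Qed.

(** For equal signs this is Bernoulli's inequality at [b / a], scaled by [a ^ r]. For opposite
    signs, [b ^ (r - 1) <= a ^ (r - 1)] gives [a ^ r + b ^ r <= (a + b) * a ^ (r - 1)]. *)
Lemma signed_powR_sub_le r a b : 1 <= r ->
  `|signed_powR r a - signed_powR r b|
    <= r * `|a - b| * Num.max `|a| `|b| `^ (r - 1).
Proof.
move=> r1; have r0 : 0 < r by lra.
move: a b; apply: sign_symmetric_ind => [a b|a b|a b|a b].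
- by rewrite distrC [`|a - b|]distrC maxC.
- by rewrite !signed_powRN !normrN -!opprD !normrN.
- case/andP=> b0 ba; have a0 := le_trans b0 ba.
  rewrite !ge0_signed_powR // !ger0_norm ?subr_ge0 ?le_powR2r ?(ltW r0) //.
  rewrite (max_idPl ba).
  have [a00|an0] := eqVneq a 0.
    have -> : b = a by apply: le_anti; rewrite ba a00.
    by rewrite !subrr mulr0 mul0r.
  have ap : 0 < a by rewrite lt_def an0.
  have := bernoulli_powR r (b / a) r1 (divr_ge0 b0 a0).
  rewrite -(ler_pM2r (powR_gt0 r ap)) -powRM ?divr_ge0 // divfK //.
  rewrite [X in X <= _](_ : _ = a `^ r - r * (a - b) * (a `^ r / a)); last first.
    by field.
  have -> : a `^ r / a = a `^ (r - 1).
    by rewrite -(mulr_powRB1 a0 r0) mulrC mulKf.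
  by lra.
- case/andP=> b0 ba; have a0 := le_trans b0 ba.
  rewrite signed_powRN !ge0_signed_powR // normrN !opprK.
  rewrite !ger0_norm ?addr_ge0 ?powR_ge0 // (max_idPl ba).
  rewrite -(mulr_powRB1 a0 r0) -(mulr_powRB1 b0 r0).
  have h : b `^ (r - 1) <= a `^ (r - 1) by rewrite le_powR2r //; lra.
  have := powR_ge0 a (r - 1); have := powR_ge0 b (r - 1).
  move: h; set A := a `^ _; set B := b `^ _ => h B0 A0.
  have : b * B <= b * A by rewrite ler_wpM2l.
  have : (a + b) * A <= r * ((a + b) * A).
    by rewrite ler_peMl // mulr_ge0 // addr_ge0.
  by rewrite mulrA; lra.
Qed.

(** For equal signs, superadditivity of the power gives constant 1. The factor [2^-1 ^ r] comes from
    opposite signs, where [(a + b) / 2 <= a]. *)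
Lemma signed_powR_sub_ge r a b : 1 <= r ->
  2^-1 `^ r * `|a - b| `^ r <= `|signed_powR r a - signed_powR r b|.
Proof.
move=> r1; have r0 : 0 < r by lra.
have half0 : 0 <= 2^-1 :> R by rewrite invr_ge0.
move: a b; apply: sign_symmetric_ind => [a b|a b|a b|a b].
- by rewrite distrC [`|signed_powR _ _ - _|]distrC.
- by rewrite !signed_powRN -!opprD !normrN.
- case/andP=> b0 ba; have a0 := le_trans b0 ba.
  rewrite !ge0_signed_powR // !ger0_norm ?subr_ge0 ?le_powR2r ?(ltW r0) //.
  have ab0 : 0 <= a - b by rewrite subr_ge0.
  apply: (@le_trans _ _ ((a - b) `^ r)).
    rewrite ler_piMl ?powR_ge0 //.
    by rewrite -[leRHS](powRr0 2^-1) ger_powR // ?ltW //; lra.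
  rewrite -(mulr_powRB1 a0 r0) -(mulr_powRB1 b0 r0).
  rewrite -(mulr_powRB1 ab0 r0).
  have r10 : 0 <= r - 1 by lra.
  have h1 : b * b `^ (r - 1) <= b * a `^ (r - 1).
    by rewrite ler_wpM2l // le_powR2r.
  have h2 : (a - b) * (a - b) `^ (r - 1) <= (a - b) * a `^ (r - 1).
    by rewrite ler_wpM2l // le_powR2r //; lra.
  by lra.
- case/andP=> b0 ba; have a0 := le_trans b0 ba.
  rewrite signed_powRN !ge0_signed_powR // !opprK.
  rewrite !ger0_norm ?addr_ge0 ?powR_ge0 // -powRM ?addr_ge0 //.
  apply: (@le_trans _ _ (a `^ r)); last by rewrite lerDl powR_ge0.
  by rewrite le_powR2r ?(ltW r0) ?mulr_ge0 ?addr_ge0 //; lra.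
Qed.

(* A substitute for Hoelder's inequality: with u = |a - b| / d and
   m = max(|a|, |b|), the product u m^(r-1) is at most max(u, m)^r. *)
Lemma signed_powR_sub_pow_le p q d a b : 0 < q -> q <= p -> 0 < d ->
  `|signed_powR (p / q) a - signed_powR (p / q) b| `^ q <=
  (p / q * d) `^ q * (d^-1 `^ p * `|a - b| `^ p + `|a| `^ p + `|b| `^ p).
Proof.
move=> q0 qp d0; have p0 : 0 < p by lra.
have r1 : 1 <= p / q by rewrite ler_pdivlMr // mul1r.
have rq : p / q * q = p by rewrite divfK ?gt_eqF.
move: r1 rq; move: (p / q) => r r1 rq.
have r0 : 0 < r by lra.
set u := d^-1 * `|a - b|; set m := Num.max `|a| `|b|; set w := Num.max u m.
have u0 : 0 <= u by rewrite mulr_ge0 // invr_ge0 ltW.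
have m0 : 0 <= m by rewrite le_max normr_ge0.
have w0 : 0 <= w by rewrite le_max u0.
have h : `|signed_powR r a - signed_powR r b| <= r * d * w `^ r.
  apply: le_trans (signed_powR_sub_le _ _ _ r1) _.
  have -> : `|a - b| = d * u by rewrite mulrA divff ?mul1r ?gt_eqF.
  rewrite mulrA -mulrA ler_wpM2l ?mulr_ge0 // ?(ltW r0) ?(ltW d0) //.
  rewrite -(mulr_powRB1 w0 r0) ler_pM ?powR_ge0 //; first by rewrite le_max lexx.
  by rewrite le_powR2r //; [lra|rewrite le_max lexx orbT].
apply: le_trans (le_powR2r _ _ _ (ltW q0) (normr_ge0 _) h) _.
rewrite powRM ?mulr_ge0 ?powR_ge0 ?(ltW r0) ?(ltW d0) //.
rewrite ler_wpM2l ?powR_ge0 // -powRrM rq.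
rewrite -powRM // ?invr_ge0 ?(ltW d0) // -/u.
have := powR_ge0 u p; have := powR_ge0 `|a| p; have := powR_ge0 `|b| p.
(* As [w] is one of [u], [|a|], [|b|], its [p]-th power is one of the three nonnegative summands. *)
by rewrite /w /m; case: (leP u) => _; [case: (leP `|a|) => _|]; lra.
Qed.

End signed_power.

(** * Powers of norms as series over the coordinates *)

Section lp_powers.
Context {R : realType} {p : R} {p1 : 1 <= p}.
Implicit Types x y : lp p1.

Lemma lp_norm_powE x :
  (`|x| `^ p)%:E = (\sum_(n <oo) (`|x n| `^ p)%:E)%E.
Proof.
have p0 : 0 < p := lt_le_trans ltr01 p1.
rewrite -poweR_EFin -[`|x|]/(lp_norm x) lp_normE -poweRrM mulVf ?gt_eqF //.
by rewrite poweRe1 // nneseries_ge0 // => n _ _; rewrite lee_fin powR_ge0.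
Qed.

Lemma lpBE x y n : (x - y) n = x n - y n.
Proof. by []. Qed.

End lp_powers.

(** * The Mazur map between the unit spheres *)

Section mazur_sphere_estimates.
Context {R : realType} {p q : R} (p1 : 1 <= p) (q1 : 1 <= q).
Implicit Types x z : lp p1.

Lemma mazur_sphereE x n : mazur_sphere p1 q1 x n = signed_powR (p / q) (x n).
Proof. by []. Qed.

Lemma norm_mazur_sphere_pow x : `|mazur_sphere p1 q1 x| `^ q = `|x| `^ p.
Proof.
have p0 : 0 < p := lt_le_trans ltr01 p1.
have q0 : 0 < q := lt_le_trans ltr01 q1.
apply: EFin_inj; rewrite !lp_norm_powE; apply: eq_eseriesr => n _.
congr EFin; rewrite mazur_sphereE /signed_powR normrM normr_sg.
have [->|xn0] := eqVneq (x n) 0.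
  by rewrite mul0r normr0 !powR0 ?gt_eqF.
by rewrite mul1r ger0_norm ?powR_ge0 // -powRrM divfK ?gt_eqF.
Qed.

Lemma norm_mazur_sphere x : `|x| = 1 -> `|mazur_sphere p1 q1 x| = 1.
Proof.
have q0 : 0 < q := lt_le_trans ltr01 q1.
move=> x1; have := norm_mazur_sphere_pow x; rewrite x1 powR1.
move=> /eqP; rewrite powR_eq1 => /or3P[/eqP//| |].
  by rewrite ltNge normr_ge0.
by rewrite gt_eqF.
Qed.

(** The coordinate bounds are summed with [d = |x - z|], for which each of the three series on the
    right has sum 1. *)
Lemma mazur_sphere_lipschitz x z : q <= p -> `|x| = 1 -> `|z| = 1 ->
  `|mazur_sphere p1 q1 x - mazur_sphere p1 q1 z| <= 3 * (p / q) * `|x - z|.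
Proof.
move=> qp x1 z1; have q0 : 0 < q := lt_le_trans ltr01 q1.
have p0 : 0 < p := lt_le_trans ltr01 p1.
have [->|xz] := eqVneq x z; first by rewrite !subrr !normr0 mulr0.
set d := `|x - z|; have d0 : 0 < d by rewrite normr_gt0 subr_eq0.
have rd0 : 0 <= p / q * d by rewrite mulr_ge0 ?divr_ge0 // ltW.
have pow0 (t : lp p1) n : (0 <= (`|t n| `^ p)%:E)%E by rewrite lee_fin powR_ge0.
have H : `|mazur_sphere p1 q1 x - mazur_sphere p1 q1 z| `^ q <=
    (p / q * d) `^ q * 3.
  rewrite -lee_fin lp_norm_powE.
  have -> : (3 : R) = d^-1 `^ p * d `^ p + `|x| `^ p + `|z| `^ p.
    rewrite x1 z1 powR1 -powRM ?invr_ge0 ?ltW // mulVf ?gt_eqF // powR1.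
    by ring.
  rewrite EFinM !EFinD EFinM !lp_norm_powE.
  rewrite -nneseriesZl // -nneseriesD //; last first.
    by move=> n _ _; rewrite mule_ge0 // lee_fin powR_ge0.
  rewrite -nneseriesD //; last first.
    by move=> n _ _; rewrite adde_ge0 // mule_ge0 // lee_fin powR_ge0.
  rewrite -nneseriesZl; last first.
    by move=> n _; rewrite !adde_ge0 // mule_ge0 // lee_fin powR_ge0.
  apply: lee_nneseries => n _; first by rewrite lee_fin powR_ge0.
  have := signed_powR_sub_pow_le p q d (x n) (z n) q0 qp d0.
  by rewrite -lee_fin EFinM !EFinD EFinM.
have three1 : 1 <= 3 :> R by rewrite ler1n.
(* Since [3 <= 3 ^ q], the factor 3 moves inside the [q]-th power before the root is taken. *)
have := le_trans H (ler_wpM2l (powR_ge0 _ _) (le1r_powR three1 q1)).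
rewrite -powRM // => /(le_powR2r q^-1 _ _ _ (powR_ge0 _ _)).
rewrite invr_ge0 => /(_ (ltW q0)); rewrite -!powRrM mulfV ?gt_eqF //.
by rewrite !powRr1 ?(mulr_ge0 rd0) // -[3 * _ * _]mulrA [3 * _]mulrC.
Qed.

(** The [q]-th power of the scalar lower bound has exponent [p] on each coordinate difference, so it
    sums to a multiple of [|x - z| ^ p]. *)
Lemma mazur_sphere_expanding x z : q <= p ->
  2^-1 `^ (p / q) * `|x - z| `^ (p / q)
    <= `|mazur_sphere p1 q1 x - mazur_sphere p1 q1 z|.
Proof.
move=> qp; have q0 : 0 < q := lt_le_trans ltr01 q1.
have p0 : 0 < p := lt_le_trans ltr01 p1.
have r1 : 1 <= p / q by rewrite ler_pdivlMr // mul1r.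
have qq : q * q^-1 = 1 by rewrite mulfV ?gt_eqF.
have powE (a : R) : a `^ p = (a `^ (p / q)) `^ q.
  by rewrite -powRrM divfK ?gt_eqF.
have H : 2^-1 `^ p * `|x - z| `^ p <=
    `|mazur_sphere p1 q1 x - mazur_sphere p1 q1 z| `^ q.
  rewrite -lee_fin EFinM !lp_norm_powE -nneseriesZl; last first.
    by move=> n _; rewrite lee_fin powR_ge0.
  apply: lee_nneseries => n _; first by rewrite -EFinM lee_fin mulr_ge0 ?powR_ge0.
  rewrite -EFinM lee_fin !lpBE !mazur_sphereE.
  rewrite 2!powE -powRM ?powR_ge0 // le_powR2r ?(ltW q0) ?mulr_ge0 ?powR_ge0 //.
  exact: signed_powR_sub_ge.
move: H; rewrite 2!powE -powRM ?powR_ge0 //.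
move=> /(le_powR2r q^-1 _ _ _ (powR_ge0 _ _)).
rewrite invr_ge0 => /(_ (ltW q0)); rewrite -!powRrM qq.
by rewrite !powRr1 ?mulr_ge0 ?powR_ge0.
Qed.

End mazur_sphere_estimates.

(** * Homogeneous extension of maps between spheres *)

(** Separates the change of direction from the change of radius. *)
Lemma scalerB_split {R : pzRingType} {U : lmodType R} (s t : R) (u v : U) :
  s *: u - t *: v = s *: (u - v) + (s - t) *: v.
Proof. by rewrite scalerBr scalerBl addrA subrK. Qed.

Section radial_extension.
Context {R : realType} {V W : normedModType R} (G : V -> W).
Implicit Types (x z : V) (c r K : R).

(** At 0 the factor [|x|] vanishes, so the value of [G] there is irrelevant. *)
Definition radial_extension x : W := `|x| *: G (`|x|^-1 *: x).

Lemma radial_extension0 : radial_extension 0 = 0.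
Proof. by rewrite /radial_extension normr0 scale0r. Qed.

Lemma norm_normalized x : x != 0 -> `| `|x|^-1 *: x| = 1.
Proof.
by move=> x0; rewrite normrZ normfV normr_id mulVf // normr_eq0.
Qed.

Lemma normalizedK x : x != 0 -> `|x| *: (`|x|^-1 *: x) = x.
Proof. by move=> x0; rewrite scalerA divff ?normr_eq0 // scale1r. Qed.

Hypothesis norm_G : forall x, `|x| = 1 -> `|G x| = 1.

Lemma norm_radial_extension x : `|radial_extension x| = `|x|.
Proof.
have [->|x0] := eqVneq x 0; first by rewrite radial_extension0 !normr0.
by rewrite normrZ normr_id norm_G ?norm_normalized // mulr1.
Qed.

(** The radial part contributes 1 to the constant and the angular part [2 * K]. If one point is 0,
    preservation of the norm suffices. *)
Lemma radial_extension_lipschitz K : 0 <= K ->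
  (forall x z, `|x| = 1 -> `|z| = 1 -> `|G x - G z| <= K * `|x - z|) ->
  forall x z, `|radial_extension x - radial_extension z|
    <= (1 + 2 * K) * `|x - z|.
Proof.
move=> K0 GK x z.
have K1 (a : R) : 0 <= a -> a <= (1 + 2 * K) * a.
  by move=> a0; rewrite ler_peMl //; lra.
have [->|x0] := eqVneq x 0.
  by rewrite radial_extension0 !sub0r !normrN norm_radial_extension K1.
have [->|z0] := eqVneq z 0.
  by rewrite radial_extension0 !subr0 norm_radial_extension K1.
rewrite distrC [`|x - z|]distrC /radial_extension scalerB_split.
set u := `|x|^-1 *: x; set v := `|z|^-1 *: z.
have u1 : `|u| = 1 by rewrite norm_normalized.
have v1 : `|v| = 1 by rewrite norm_normalized.
have st : `| `|z| - `|x| | <= `|z - x| by apply: ler_dist_dist.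
(* The splitting of [z - x], solved for its angular part, leaves two terms of norm at most
   [|z - x|]. *)
have zuv : `|z| * `|v - u| <= 2 * `|z - x|.
  have -> : `|z| * `|v - u| = `|(z - x) - (`|z| - `|x|) *: u|.
    rewrite -{1}[`|z|]normr_id -normrZ; congr `|_|.
    have -> : z - x = `|z| *: v - `|x| *: u by rewrite !normalizedK.
    by rewrite (scalerB_split `|z| `|x|) addrK.
  apply: le_trans (ler_normB _ _) _.
  by rewrite normrZ u1; lra.
apply: le_trans (ler_normD _ _) _.
rewrite !normrZ normr_id (norm_G _ u1) mulr1.
have := ler_wpM2l (normr_ge0 z) (GK v u v1 u1).
have := ler_wpM2l K0 zuv.
by rewrite !mulrA [K * `|z|]mulrC; lra.
Qed.

(* With F the radial extension and s = |x| >= |z|, either |F x - F z| is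
   comparable to |x - z|, or |x| and |z| are so close that the normalized vectors
   are at distance at least |x - z| / (2 s). *)
Lemma radial_extension_dichotomy c r : 0 <= c -> 1 <= r ->
  (forall x z, `|x| = 1 -> `|z| = 1 -> c * `|x - z| `^ r <= `|G x - G z|) ->
  forall x z,
    `|x - z| / 2 <= `|radial_extension x - radial_extension z| \/
    c * (`|x - z| / 2) `^ r <=
      2 * `|radial_extension x - radial_extension z|
        * Num.max `|x| `|z| `^ (r - 1).
Proof.
move=> c0 r1 Gc x z; have r0 : 0 < r by lra.
wlog zx : x z / `|z| <= `|x|.
  move=> h; case/orP: (le_total `|z| `|x|) => /h //.
  by rewrite distrC [`|radial_extension _ - _|]distrC maxC.
rewrite (max_idPl zx).
have [->|z0] := eqVneq z 0.
  left; rewrite radial_extension0 !subr0 norm_radial_extension.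
  by have := normr_ge0 x; lra.
have zp : 0 < `|z| by rewrite normr_gt0.
have xp : 0 < `|x| := lt_le_trans zp zx.
have x0 : x != 0 by rewrite -normr_gt0.
set d := `|x - z|; set D := `|radial_extension x - radial_extension z|.
have [h|Dd] := leP (d / 2) D; [by left|right].
(* Preservation of the norm makes the difference of the radii a lower bound for [D], hence less than
   [d / 2]. *)
have stD : `|x| - `|z| <= D.
  by rewrite -(norm_radial_extension x) -(norm_radial_extension z) lerB_dist.
set u := `|x|^-1 *: x; set v := `|z|^-1 *: z.
have u1 : `|u| = 1 by rewrite norm_normalized.
have v1 : `|v| = 1 by rewrite norm_normalized.
have suv : d / 2 <= `|x| * `|u - v|.
  have : d <= `|x| * `|u - v| + (`|x| - `|z|).
    have -> : d = `| `|x| *: u - `|z| *: v| by rewrite !normalizedK.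
    rewrite (scalerB_split `|x| `|z|); apply: le_trans (ler_normD _ _) _.
    rewrite (normrZ _ (u - v)) (normrZ _ v) normr_id v1 mulr1.
    by rewrite [X in _ + X]ger0_norm // subr_ge0.
  by lra.
(* The splitting of the image difference, solved for its angular part, costs [D] plus the difference
   of the radii. *)
have sGuv : `|x| * `|G u - G v| <= 2 * D.
  have : `|x| * `|G u - G v| <= D + (`|x| - `|z|).
    have -> : `|x| * `|G u - G v| =
        `|radial_extension x - radial_extension z - (`|x| - `|z|) *: G v|.
      rewrite /radial_extension (scalerB_split `|x| `|z|) addrK.
      by rewrite normrZ normr_id.
    apply: le_trans (ler_normB _ _) _.
    by rewrite normrZ norm_G // mulr1 [X in _ + X]ger0_norm // subr_ge0.
  by lra.
apply: (@le_trans _ _ (c * (`|x| * `|u - v|) `^ r)).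
  by rewrite ler_wpM2l // le_powR2r ?(ltW r0) // divr_ge0 // normr_ge0.
(* One factor [|x|] of [|x| ^ r] is spent on [sGuv]; the others form the power on the right. *)
rewrite powRM // -(mulr_powRB1 (normr_ge0 x) r0).
have -> : c * (`|x| * `|x| `^ (r - 1) * `|u - v| `^ r) =
  (`|x| * (c * `|u - v| `^ r)) * `|x| `^ (r - 1) by ring.
rewrite ler_wpM2r ?powR_ge0 //; apply: le_trans sGuv.
by rewrite ler_wpM2l // Gc.
Qed.

(* On pairs with L m^alpha <= |x - z|, where m = max(|x|, |z|), the factor
   m^(r-1) of the dichotomy is at most (|x - z| / L)^((r-1)/alpha). *)
Lemma radial_extension_rate c r alpha L :
  0 < c -> 1 <= r -> 0 < alpha -> 0 < L ->
  (forall x z, `|x| = 1 -> `|z| = 1 -> c * `|x - z| `^ r <= `|G x - G z|) ->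
  exists2 k : R, 0 < k & forall x z,
    L * Num.max (`|x| `^ alpha) (`|z| `^ alpha) + L <= `|x - z| ->
    k * Num.min `|x - z| (`|x - z| `^ (r - (r - 1) / alpha))
      <= `|radial_extension x - radial_extension z|.
Proof.
move=> c0 r1 a0 L0 Gc.
set e := (r - 1) / alpha.
(* This is the constant obtained by solving [c * (d / 2) ^ r <= 2 * D * (d / L) ^ e] for [D]; the
   first alternative of the dichotomy gives [2^-1]. *)
pose k1 := c * 2^-1 `^ r * L `^ e / 2.
have k10 : 0 < k1 by rewrite /k1 !(mulr_gt0, powR_gt0).
have kp : 0 < Num.min 2^-1 k1 by rewrite lt_min k10 invr_gt0 andbT.
exists (Num.min 2^-1 k1) => //.
move=> x z; set m := Num.max `|x| `|z|.
have m0 : 0 <= m by rewrite le_max normr_ge0.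
have -> : Num.max (`|x| `^ alpha) (`|z| `^ alpha) = m `^ alpha.
  rewrite /m; case: (leP `|x| `|z|) => h.
    by rewrite (max_idPr _) // le_powR2r // ltW.
  by rewrite (max_idPl _) // le_powR2r // ltW.
set d := `|x - z| => Ld.
have ma0 : 0 <= L * m `^ alpha by rewrite mulr_ge0 ?powR_ge0 // ltW.
(* The additive [L] forces [d >= L > 0], which allows division by powers of [d]. *)
have d0 : 0 < d by lra.
have md : m `^ (r - 1) <= (d / L) `^ e.
  have -> : m `^ (r - 1) = (m `^ alpha) `^ e.
    by rewrite -powRrM /e mulrC divfK ?gt_eqF.
  rewrite le_powR2r ?powR_ge0 //; first by rewrite divr_ge0 ?(ltW a0) //; lra.
  by rewrite ler_pdivlMr // mulrC; lra.
have min0 : 0 <= Num.min d (d `^ (r - e)) by rewrite le_min powR_ge0 ltW.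
have [h|h] := radial_extension_dichotomy _ _ (ltW c0) r1 Gc x z.
  apply: le_trans h; rewrite -/d [d / 2]mulrC.
  by rewrite ler_pM ?ge_min ?lexx // ltW.
apply: (@le_trans _ _ (k1 * d `^ (r - e))).
  by rewrite ler_pM ?ge_min ?lexx ?orbT // ltW.
move: h; rewrite -/m -/d; set D := `|_ - _| => h.
have {}h : c * (d / 2) `^ r <= 2 * D * (d / L) `^ e.
  by apply: le_trans h _; rewrite ler_wpM2l ?mulr_ge0 ?normr_ge0 //.
have dLe : 0 < L `^ e / d `^ e by rewrite divr_gt0 ?powR_gt0.
move: h; rewrite -(ler_pM2r dLe).
rewrite !powRM ?invr_ge0 ?(ltW d0) ?(ltW L0) // -[L^-1]powR_inv1 ?(ltW L0) //.
rewrite -powRrM mulN1r powRN powRB ?(gt_eqF d0) ?implybT //.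
have Le0 : L `^ e != 0 by rewrite gt_eqF ?powR_gt0.
have de0 : d `^ e != 0 by rewrite gt_eqF ?powR_gt0.
have -> : 2 * D * (d `^ e * (L `^ e)^-1) * (L `^ e / d `^ e) = 2 * D
  by field; rewrite ?Le0 ?de0.
rewrite -(ler_pM2l (_ : 0 < 2 :> R)) // /k1.
set A := d `^ r / d `^ e.
have -> : c * (d `^ r * 2^-1 `^ r) * (L `^ e / d `^ e) =
  c * 2^-1 `^ r * L `^ e * A by rewrite /A; ring.
by lra.
Qed.

End radial_extension.

(** * Coarseness and divergence of the lower modulus *)

Section expansion_rates.
Context {R : realType} {X Y : normedModType R}.
Implicit Types f : X -> Y.

Lemma lipschitz_coarse (K : R) f : 0 <= K ->
  (forall x z, `|f x - f z| <= K * `|x - z|) -> coarse f.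
Proof.
move=> K0 fK t t0; apply: (@le_lt_trans _ _ (K * t)%:E); last exact: ltry.
apply: ge_ereal_sup => _ [x [z [xz ->]]]; rewrite lee_fin.
by apply: le_trans (fK x z) _; rewrite ler_wpM2l.
Qed.

Lemma cvg_min_powR_pinfty (k b : R) : 0 < k -> 0 < b ->
  k * Num.min t (t `^ b) @[t --> +oo] --> +oo.
Proof.
move=> k0 b0; apply/cvgryPge => A.
(* Truncation at 0 ensures that [B] has a root of order [b]; it suffices that [t] exceeds both [B]
   and that root. *)
set B := Num.max A 0 / k.
have B0 : 0 <= B by rewrite divr_ge0 ?(ltW k0) // le_max lexx orbT.
near=> t.
apply: (@le_trans _ _ (k * B)).
  by rewrite /B mulrC divfK ?gt_eqF // le_max lexx.
rewrite ler_pM2l // le_min; apply/andP; split.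
  by near: t; apply: nbhs_pinfty_ge; exact: num_real.
have -> : B = (B `^ b^-1) `^ b by rewrite -powRrM mulVf ?gt_eqF // powRr1.
rewrite le_powR2r ?powR_ge0 ?(ltW b0) //.
Unshelve. all: by end_near. Qed.

End expansion_rates.

(** * The Mazur map on the whole space *)

Section mazur.
Context {R : realType} {p q : R} (p1 : 1 <= p) (q1 : 1 <= q).

Lemma mazurE (x : lp p1) :
  mazur p1 q1 x = radial_extension (mazur_sphere p1 q1) x.
Proof.
rewrite /mazur; case: eqVneq => [->|//].
by rewrite radial_extension0.
Qed.

Lemma mazur_rate (alpha L : R) : q <= p -> 0 < alpha -> 0 < L ->
  exists2 k : R, 0 < k & forall x z : lp p1,
    L * Num.max (`|x| `^ alpha) (`|z| `^ alpha) + L <= `|x - z| ->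
    k * Num.min `|x - z| (`|x - z| `^ (p / q - (p / q - 1) / alpha))
      <= `|mazur p1 q1 x - mazur p1 q1 z|.
Proof.
move=> qp a0 L0.
have r1 : 1 <= p / q by rewrite ler_pdivlMr ?mul1r // (lt_le_trans ltr01).
have c0 : 0 < 2^-1 `^ (p / q) :> R by rewrite powR_gt0 ?invr_gt0.
have [k k0 H] := radial_extension_rate _ (norm_mazur_sphere p1 q1) _ _ _ _
  c0 r1 a0 L0 (fun x z _ _ => mazur_sphere_expanding p1 q1 x z qp).
by exists k => // x z /H; rewrite !mazurE.
Qed.

End mazur.

Theorem theorem1p2 (R : realType) (p q alpha : R) (p1 : 1 <= p) (q1 : 1 <= q)
    (qp : q < p) (halpha : (p - q) / p < alpha <= 1) :
  [/\ coarse (mazur p1 q1),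
      expanding_at_rate alpha (mazur p1 q1) &
      linearly_expanding_at_rate 1 (mazur p1 q1)].
Proof.
have p0 : 0 < p := lt_le_trans ltr01 p1.
have q0 : 0 < q := lt_le_trans ltr01 q1.
have r0 : 0 <= p / q by rewrite divr_ge0 // ltW.
have [ha _] := andP halpha.
have a0 : 0 < alpha by apply: lt_trans ha; rewrite divr_gt0 // subr_gt0.
split.
- apply: (@lipschitz_coarse _ _ _ (1 + 2 * (3 * (p / q)))).
    by rewrite addr_ge0 // mulr_ge0 // mulr_ge0.
  move=> x z; rewrite !mazurE.
  apply: radial_extension_lipschitz => //.
  + exact: norm_mazur_sphere.
  + by rewrite mulr_ge0.
  + by move=> {}x {}z; apply: mazur_sphere_lipschitz; apply: ltW.
- move=> L L0; have [k k0 H] := mazur_rate p1 q1 alpha L (ltW qp) a0 L0.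
  set b := p / q - (p / q - 1) / alpha in H.
  have b0 : 0 < b.
    (* Positivity means [p / q - 1 < alpha * (p / q)] up to order of factors; multiplied by [q / p],
       this is the hypothesis on [alpha]. *)
    rewrite subr_gt0 ltr_pdivrMr // -(ltr_pM2l (divr_gt0 q0 p0)).
    have -> : q / p * (p / q - 1) = (p - q) / p by field; rewrite !gt_eqF.
    by rewrite mulrA mulf_div [q * p]mulrC divff ?mul1r // mulf_neq0 ?gt_eqF.
  exists (fun t => k * Num.min t (t `^ b)); split=> //.
  + by move=> t t0; rewrite mulr_ge0 ?(ltW k0) // le_min t0 powR_ge0.
  + exact: cvg_min_powR_pinfty.
- move=> L L0; have [k k0 H] := mazur_rate p1 q1 1 L (ltW qp) ltr01 L0.
  (* At rate 1 the exponent is 1 and the minimum is [|x - z|], so the bound is linear with slope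
     [k]; subtracting [k^-1] only weakens it. *)
  exists k^-1; rewrite ?invr_gt0 // => x z /H.
  rewrite divr1 opprB addrCA subrr addr0 powRr1 // minxx invrK => h.
  by apply: le_trans h; rewrite lerBlDr lerDl invr_ge0 ltW.
Qed.
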